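(* Let $X$ be a $k$-regular connected graph and $S$ a nonempty set of marked vertices, $\overline S=V\setminus S$. Let $A(X\setminus S)=\sum_r\lambda_rG_r$ be the spectral decomposition of $X\setminus S$. Then, entrywise, $$\widehat M[S,S]\le\frac1{2k}I\circ\left(L/L_{\overline S}+Q/Q_{\overline S}\right)-\frac1{2k}L_S+\frac k2H\left(\sum_r\frac{1}{(k^2-\lambda_r^2)^2}G_r^{\circ2}\right)H^T\Delta(S,\overline S)+\frac1{4k}H\left((L_{\overline S}^{-1})^{\circ2}+(Q_{\overline S}^{-1})^{\circ2}\right)H^T\Delta(S,\overline S).$$ Moreover, equality holds if and only if every vertex in $S$ has at most one neighbor in $X\setminus S$.
   Context: Walk: arcs are ordered pairs $(u,v)$ of adjacent vertices; $R$ the arc-reversal matrix; $D_t$ the tail incidence matrix ($(D_t)_{x,(u,v)}=1$ iff $x=u$); $O_S$ the identity with $[S,S]$ block zeroed; $U=R(\frac2kD_t^TO_SD_t-I)$. Average vertex mixing matrix: $\widehat M_{u,v}=\lim_{T\to\infty}\frac1T\sum_{t=0}^{T-1}\sum_{w\sim u}|(U^tx_v)_{(u,w)}|^2$, $x_v=k^{-1/2}D_t^Te_v$. Write $A=\begin{pmatrix}A_S&H\\H^T&A_{\overline S}\end{pmatrix}$, $L=kI-A$, $Q=kI+A$, $L_S=L[S,S]$, $Q_S=Q[S,S]$, $L_{\overline S}=L[\overline S,\overline S]$, $Q_{\overline S}=Q[\overline S,\overline S]$, and the Schur complements $L/L_{\overline S}=L_S-HL_{\overline S}^{-1}H^T$,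 $Q/Q_{\overline S}=Q_S-HQ_{\overline S}^{-1}H^T$. $\Delta(S,\overline S)$ is the diagonal $S\times S$ matrix whose $(a,a)$ entry is the number of neighbors of $a$ in $\overline S$. $\circ$ is the Schur product, $N^{\circ2}=N\circ N$. *)

(* Defs.v *)
From mathcomp Require Import all_boot all_order all_algebra.
From mathcomp Require Import all_classical all_reals all_analysis.

Set Implicit Arguments.
Unset Strict Implicit.
Unset Printing Implicit Defensive.

Import Order.TTheory GRing.Theory Num.Theory.
Import numFieldNormedType.Exports.
Local Open Scope ring_scope.

(* The rows and columns of a matrix indexed by a finite type [T] are numbered
   by 'I_#|T| through [enum_val] and [enum_rank]. *)

Section Matrices.
Variables (R : realType) (V : finType).

Definition submatrix (M : 'M[R]_#|V|) (A B : {set V}) : 'M[R]_(#|A|, #|B|) :=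
  \matrix_(i, j) M (enum_rank (enum_val i)) (enum_rank (enum_val j)).

Definition schur_prod m n (M N : 'M[R]_(m, n)) : 'M[R]_(m, n) :=
  \matrix_(i, j) (M i j * N i j).

(* The lam r are the distinct eigenvalues of A, and G r is the orthogonal
   projection onto the eigenspace of lam r. MathComp eigenspaces consist of row
   vectors, which makes no difference for the symmetric matrices used here. *)
Definition spectral_decomposition m (A : 'M[R]_m) (d : nat) (lam : 'I_d -> R)
    (G : 'I_d -> 'M[R]_m) : Prop :=
  [/\ injective lam,
      forall r, eigenvalue A (lam r),
      forall r, [/\ (G r)^T = G r, G r *m G r = G r
                  & (G r :=: eigenspace A (lam r))%MS],
      \sum_r G r = 1%:M
    & A = \sum_r lam r *: G r].

End Matrices.

Section Graph.
Variables (R : realType) (V : finType) (adj : rel V) (k : nat) (S : {set V}).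

Definition connected_graph : Prop := forall x y : V, connect adj x y.

Definition regular_graph : Prop := forall x : V, #|[set y | adj x y]| = k.

Definition adjmx : 'M[R]_#|V| :=
  \matrix_(i, j) (adj (enum_val i) (enum_val j))%:R.

Definition lapl : 'M[R]_#|V| := k%:R%:M - adjmx.
Definition slapl : 'M[R]_#|V| := k%:R%:M + adjmx.

Definition blockH : 'M[R]_(#|S|, #|~: S|) := submatrix adjmx S (~: S).

(* The off-diagonal blocks of lapl are - blockH and its transpose; the two signs
   cancel in the Schur complement. *)
Definition schurL : 'M[R]_#|S| :=
  submatrix lapl S S
  - blockH *m invmx (submatrix lapl (~: S) (~: S)) *m blockH^T.

Definition schurQ : 'M[R]_#|S| :=
  submatrix slapl S S
  - blockH *m invmx (submatrix slapl (~: S) (~: S)) *m blockH^T.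

Definition out_deg (a : V) : nat := #|[set b in ~: S | adj a b]|.

Definition out_degmx : 'M[R]_#|S| :=
  diag_mx (\row_i (out_deg (enum_val i))%:R).

Definition graph_arc : Type := {a : V * V | adj a.1 a.2}.

Definition arc_tail (a : graph_arc) : V := (val a).1.
Definition arc_head (a : graph_arc) : V := (val a).2.

Definition reversal : 'M[R]_#|{: graph_arc}| :=
  \matrix_(i, j) ((arc_tail (enum_val i) == arc_head (enum_val j)) &&
                  (arc_head (enum_val i) == arc_tail (enum_val j)))%:R.

Definition tail_inc : 'M[R]_(#|V|, #|{: graph_arc}|) :=
  \matrix_(i, j) (enum_val i == arc_tail (enum_val j))%:R.

Definition zeroed_id : 'M[R]_#|V| :=
  \matrix_(i, j) if (enum_val i \in S) && (enum_val j \in S) then 0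
                 else (i == j)%:R.

(* One step of the walk driven by the unmarked vertices: on arcs with marked
   tail the coin is -1. *)
Definition walk : 'M[R]_#|{: graph_arc}| :=
  reversal *m ((2 / k%:R) *: (tail_inc^T *m zeroed_id *m tail_inc) - 1%:M).

Definition init_state (v : V) : 'cV[R]_#|{: graph_arc}| :=
  (Num.sqrt k%:R)^-1 *: (tail_inc^T *m delta_mx (enum_rank v) 0).

(* Probability of being at u after t steps, starting from the uniform
   superposition of the arcs with tail v. *)
Definition vertex_prob (t : nat) (u v : V) : R :=
  \sum_(a : graph_arc | arc_tail a == u)
     `| (walk ^+ t *m init_state v) (enum_rank a) 0 | ^+ 2.

Definition avg_mixing : 'M[R]_#|V| :=
  \matrix_(i, j)
    limn (fun T : nat =>
      T%:R^-1 * \sum_(0 <= t < T) vertex_prob t (enum_val i) (enum_val j)).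

End Graph.

(* Main.v *)
(* Let R be the arc reversal and N the tail incidence matrix of the unmarked
   vertices, scaled so that N N^T = I. If f is an eigenvector of X \ S with
   eigenvalue k cos th, then N^T f and R N^T f span a plane that the walk rotates
   by th, and on the orthogonal complement of all these planes the walk is -R.
   Hence, at an arc with marked tail, the state started at a marked vertex is
   c_0 + c_1 (-1)^t + sum_r c_r cos(t th_r); since |lam_r| < k, the Cesaro mean of
   its square is c_0^2 + c_1^2 + (1/2) sum_r c_r^2. Summing over arcs gives an exact
   formula for the mixing matrix, in which sums of entries of G_r and of the inverses
   of the unmarked blocks of L and Q, over the unmarked neighbours of a marked vertex
   v, are squared. The bound replaces each square of a sum by (out-degree of v) times
   the sum of squares, and equality makes G_r(x, .) constant on the unmarked
   neighbours of v for x among them; as sum_r G_r = I, there is at most one. *)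
Require Import Defs.
From mathcomp Require Import all_boot all_order all_algebra.
From mathcomp Require Import all_classical all_reals all_analysis.
From mathcomp Require Import ring lra.
Import Order.TTheory GRing.Theory Num.Theory.
Import numFieldNormedType.Exports.
Local Open Scope ring_scope.
Local Open Scope classical_set_scope.

(** * Cesaro means of trigonometric sums *)

Section CesaroMeans.
Context {R : realType}.
Implicit Types (u : nat -> R) (l M a b : R).

Definition mean_to u l :=
  (fun T : nat => T%:R^-1 * \sum_(0 <= t < T) u t) @ \oo --> l.

Lemma mean_to_sum (I : finType) (P : pred I) (c l : I -> R) (u : I -> nat -> R) :
  (forall i, P i -> mean_to (u i) (l i)) ->
  mean_to (fun t => \sum_(i | P i) c i * u i t) (\sum_(i | P i) c i * l i).
Proof.
move=> ul; rewrite /mean_to.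
have -> : (fun T : nat => T%:R^-1 * \sum_(0 <= t < T) \sum_(i | P i) c i * u i t)
    = (fun T : nat => \sum_(i | P i) c i * (T%:R^-1 * \sum_(0 <= t < T) u i t)).
  apply/funext => T; rewrite exchange_big mulr_sumr /=.
  by apply: eq_bigr => i _; rewrite -mulr_sumr mulrCA.
apply: cvg_big => [|i Pi]; first exact: add_continuous.
by apply: cvgM; [exact: cvg_cst|exact: ul].
Qed.

(** Dividing the bounded sums by [T] leaves an error of at most [M / T], which squeezes the mean to
    [l]. *)
Lemma mean_to_bounded_sum M u l :
  (forall T, `|\sum_(0 <= t < T) (u t - l)| <= M) -> mean_to u l.
Proof.
move=> uM; rewrite /mean_to -cvg_shiftS.
have h0 s : (fun n : nat => l + s * M * n.+1%:R^-1) @ \oo --> l.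
  rewrite -[X in _ --> X]addr0 -[X in _ --> _ + X](mulr0 (s * M)).
  apply: cvgD; first exact: cvg_cst.
  by apply: cvgM; [exact: cvg_cst|exact: cvg_harmonic].
apply: squeeze_cvgr (h0 (-1)) (h0 1); near=> n => /=.
have n0 : (0 : R) < n.+1%:R by rewrite ltr0n.
have := uM n.+1; rewrite sumrB sumr_const_nat subn0 ler_norml => /andP[lo hi].
have E (s : R) : l + s * M * n.+1%:R^-1 = n.+1%:R^-1 * (l *+ n.+1 + s * M).
  by rewrite mulrDr -[l *+ _]mulr_natr mulrCA mulVf ?gt_eqF// mulr1 mulrC.
rewrite !E !ler_pM2l ?invr_gt0//.
by apply/andP; split; lra.
Unshelve. all: by end_near. Qed.

Lemma cos_natmul_eq1 a : cos a = 1 -> forall t : nat, cos (t%:R * a) = 1.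
Proof.
move=> a1; have s0 : sin a = 0 by apply: cos1sin0; rewrite a1 normr1.
elim=> [|t IH]; first by rewrite mul0r cos0.
by rewrite -natr1 mulrDl mul1r cosD IH a1 s0 mulr0 subr0 mulr1.
Qed.

(** If [cos a = 1] every term is 1; otherwise the sums telescope after multiplication by
    [2 * (1 - cos a)] and stay bounded. *)
Lemma mean_to_cos a : mean_to (fun t => cos (t%:R * a)) (cos a == 1)%:R.
Proof.
have [a1|a1] := eqVneq (cos a) 1.
  apply: (mean_to_bounded_sum 0) => T.
  by rewrite big1 ?normr0// => t _; rewrite cos_natmul_eq1// subrr.
have d0 : 2 * (1 - cos a) > 0.
  by rewrite mulr_gt0// subr_gt0 lt_neqAle a1 cos_le1.
apply: (mean_to_bounded_sum ((2 * (1 - cos a))^-1 * (2 + `|1 - cos a|))) => T.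
rewrite mulrC ler_pdivlMr// -[X in _ * X]gtr0_norm// -normrM mulr_suml.
(* 2(1 - cos a) cos(ta) = (cos(ta) - cos((t+1)a)) - (cos((t-1)a) - cos(ta)) *)
have -> : \sum_(0 <= t < T) (cos (t%:R * a) - false%:R) * (2 * (1 - cos a))
    = cos (T%:R * a - a) - cos (T%:R * a) + (1 - cos a).
  elim: T => [|T IH].
    by rewrite big_nil mul0r sub0r cosN cos0; ring.
  rewrite big_nat_recr//= IH.
  have -> : T.+1%:R * a = T%:R * a + a by rewrite -natr1 mulrDl mul1r.
  by rewrite addrK cosB cosD subr0; ring.
by rewrite (le_trans (ler_normD _ _))// lerD2r (le_trans (ler_normB _ _))// lerD ?cos_max.
Qed.

Lemma cosM_half a b : cos a * cos b = 2^-1 * (cos (a + b) + cos (a - b)).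
Proof. by rewrite cosB cosD; field. Qed.

Lemma cosB_eq1 a b : cos (a - b) = 1 -> cos a = cos b.
Proof.
move=> ab; have s0 : sin (a - b) = 0 by apply: cos1sin0; rewrite ab normr1.
by rewrite -[a](subrK b) cosD ab s0 mul0r subr0 mul1r.
Qed.

Lemma mean_to_cosM a b : mean_to (fun t => cos (t%:R * a) * cos (t%:R * b))
  (2^-1 * ((cos (a + b) == 1)%:R + (cos (a - b) == 1)%:R)).
Proof.
have := @mean_to_sum bool xpredT (fun=> 2^-1)
  (fun c => (cos (if c then a + b else a - b) == 1)%:R)
  (fun c t => cos (t%:R * if c then a + b else a - b))
  (fun c _ => mean_to_cos _).
rewrite big_bool /= -mulrDr; congr mean_to.
apply/funext => t; rewrite big_bool cosM_half /=.
by rewrite -[t%:R * a + _]mulrDr -[t%:R * a - _]mulrBr [RHS]mulrDr.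
Qed.

(** Cross terms average to 0, since [th i + th j] or [th i - th j] is a multiple of [2 * pi] only if
    the two cosines agree. A diagonal term averages to 1 if [2 * th i] is such a multiple and to 1/2
    otherwise. *)
Lemma mean_to_sqr_sum_cos (I : finType) (c th : I -> R) :
  injective (cos \o th) ->
  mean_to (fun t => (\sum_i c i * cos (t%:R * th i)) ^+ 2)
    (\sum_i c i ^+ 2 * (if cos (th i) ^+ 2 == 1 then 1 else 2^-1)).
Proof.
move=> th_inj.
have := @mean_to_sum (I * I)%type xpredT (fun p => c p.1 * c p.2) _ _
  (fun p _ => mean_to_cosM (th p.1) (th p.2)).
congr mean_to.
  apply/funext => t; rewrite expr2 big_distrlr pair_big /=.
  by apply: eq_bigr => p _; ring.
rewrite -(pair_big xpredT xpredT (fun i j => c i * c j *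
  (2^-1 * ((cos (th i + th j) == 1)%:R + (cos (th i - th j) == 1)%:R)))) /=.
apply: eq_bigr => i _; rewrite (bigD1 i)//= big1 ?addr0 => [|j ji].
  rewrite subrr cos0 eqxx expr2; congr (_ * _).
  rewrite cosD -!expr2 (sin2cos2 (th i)).
  have -> : cos (th i) ^+ 2 - (1 - cos (th i) ^+ 2) = 2 * cos (th i) ^+ 2 - 1 by ring.
  have -> : (2 * cos (th i) ^+ 2 - 1 == 1) = (cos (th i) ^+ 2 == 1).
    by apply/eqP/eqP => h; lra.
  by case: ifP => _ /=; field.
have [/cosB_eq1 /th_inj ij|_] := eqVneq (cos (th i - th j)) 1.
  by rewrite ij eqxx in ji.
have [|_] := eqVneq (cos (th i + th j)) 1; last by rewrite addr0 !mulr0.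
(* The sum is read as [th i - (- th j)], and the cosine is even. *)
rewrite -[X in _ + X]opprK => /cosB_eq1; rewrite cosN => /th_inj ij.
by rewrite ij eqxx in ji.
Qed.

End CesaroMeans.

(** * The walk on functions of arcs *)

Section WalkOnArcs.
Context {R : realType} {V : finType} (adj : rel V) (k : nat) (S : {set V}).
Hypothesis adj_sym : symmetric adj.
Implicit Types (g : V -> V -> R) (u v w x y : V).

(** States are given by functions of tail and head, so that reversing arcs becomes swapping
    arguments. *)
Definition arc_vec g : 'cV[R]_#|{: graph_arc adj}| :=
  \col_i g (arc_tail (enum_val i)) (arc_head (enum_val i)).

Lemma sum_arc_tail (F : V -> V -> R) x :
  \sum_(a : graph_arc adj | arc_tail a == x) F (arc_tail a) (arc_head a)
  = \sum_(y | adj x y) F x y.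
Proof.
rewrite -(big_sub_cond (fun p : V * V => adj p.1 p.2)
  (fun p => p.1 == x) (fun p => F p.1 p.2)).
rewrite (eq_bigl (fun p : V * V => (p.1 == x) && adj p.1 p.2)); last first.
  by move=> p; rewrite andbC.
rewrite -(pair_big_dep (fun u => u == x) (fun u w => adj u w) (fun u w => F u w)) /=.
by rewrite big_pred1_eq.
Qed.

Lemma sum_arc_index (F : graph_arc adj -> R) (P : pred (graph_arc adj)) :
  \sum_(j < #|{: graph_arc adj}| | P (enum_val j)) F (enum_val j)
  = \sum_(a | P a) F a.
Proof.
rewrite -(big_enum_val_cond (A := {: graph_arc adj}) P).
by apply: eq_bigl => a; rewrite inE.
Qed.

Lemma tail_inc_arc_vec g x :
  (tail_inc R adj *m arc_vec g) (enum_rank x) 0 = \sum_(y | adj x y) g x y.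
Proof.
rewrite mxE -sum_arc_tail -sum_arc_index [RHS]big_mkcond /=.
apply: eq_bigr => j _; rewrite !mxE enum_rankK eq_sym.
by case: eqP => _; rewrite ?mul1r ?mul0r.
Qed.

(** The coin turns [g] into [h]; the reversal then swaps tail and head, so the new value at [(u, w)]
    depends on the arcs leaving [w]. *)
Lemma walk_arc_vec g :
  walk R adj k S *m arc_vec g = arc_vec (fun u w =>
    (if w \in S then 0 else 2 / k%:R * \sum_(y | adj w y) g w y) - g w u).
Proof.
set h := fun w u =>
  (if w \in S then 0 else 2 / k%:R * \sum_(y | adj w y) g w y) - g w u.
have coin : ((2 / k%:R) *: ((tail_inc R adj)^T *m zeroed_id R S *m tail_inc R adj)
    - 1%:M) *m arc_vec g = arc_vec h.
  rewrite mulmxBl mul1mx -scalemxAl -!mulmxA; apply/matrixP => i j.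
  rewrite ord1 !mxE /h; congr (_ - _).
  rewrite (bigD1 (enum_rank (arc_tail (enum_val i)))) //= big1 ?addr0; last first.
    move=> x /eqP nx; rewrite mxE mxE; case: eqP => [e|]; last by rewrite mul0r.
    by case: nx; rewrite -e enum_valK.
  rewrite !mxE enum_rankK eqxx mul1r.
  rewrite (bigD1 (enum_rank (arc_tail (enum_val i)))) //= big1 ?addr0; last first.
    move=> y ny; rewrite mxE [_ == y]eq_sym (negbTE ny).
    by case: ifP => _; rewrite mul0r.
  rewrite tail_inc_arc_vec mxE enum_rankK eqxx andbb.
  by case: ifP => _; rewrite ?mul0r ?mulr0 ?mul1r.
rewrite /walk -mulmxA coin; apply/matrixP => i j; rewrite ord1 !mxE.
case ei : (enum_val i) => [[u w] /= uw].
have wu : adj w u by rewrite adj_sym.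
pose b : graph_arc adj := exist _ (w, u) wu.
rewrite (bigD1 (enum_rank b)) //= big1 ?addr0; last first.
  move=> x /eqP nx; rewrite !mxE ei; case: andP => [[/eqP e1 /eqP e2]|]; last first.
    by rewrite mul0r.
  case: nx; rewrite -[x]enum_valK; congr enum_rank; apply: val_inj => /=.
  by rewrite (surjective_pairing (val _)); congr (_, _).
by rewrite !mxE enum_rankK ei /arc_tail /arc_head /= !eqxx mul1r.
Qed.

Lemma vertex_probE (g : nat -> V -> V -> R) v :
  (forall t, walk R adj k S ^+ t *m init_state R adj k v = arc_vec (g t)) ->
  forall t u, vertex_prob R adj k S t u v = \sum_(w | adj u w) g t u w ^+ 2.
Proof.
move=> gE t u; rewrite /vertex_prob -(sum_arc_tail (fun x y => g t x y ^+ 2)).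
apply: eq_bigr => a _.
by rewrite gE mxE enum_rankK real_normK ?num_real.
Qed.

Lemma init_stateE v :
  init_state R adj k v = arc_vec (fun u _ => (Num.sqrt k%:R)^-1 * (u == v)%:R).
Proof.
apply/matrixP => i j; rewrite ord1 !mxE; congr (_ * _).
rewrite (bigD1 (enum_rank v)) //= big1 ?addr0 => [|x nx]; last first.
  by rewrite !mxE (negbTE nx) mulr0.
by rewrite !mxE enum_rankK !eqxx mulr1 eq_sym.
Qed.

End WalkOnArcs.

(** * The walk started at a marked vertex *)

Section WalkFormula.
Context {R : realType} {V : finType} (adj : rel V) (k : nat) (S : {set V}).
Context (d : nat) (lam : 'I_d -> R) (F : 'I_d -> V -> R) (v : V).
Hypotheses (adj_sym : symmetric adj) (adj_reg : regular_graph adj k).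
Hypothesis k_gt0 : (0 < k)%N.
Hypothesis lam_inj : injective lam.
Hypothesis lam_lt : forall r, `|lam r| < k%:R.
Hypothesis v_marked : v \in S.
(** [F r] models the projection of the indicator of the unmarked neighbours of [v] onto the
    eigenspace of [lam r], extended by zero to [S]. *)
Hypothesis F_marked : forall r x, x \in S -> F r x = 0.
Hypothesis F_eigen : forall r x, x \notin S ->
  \sum_(y | adj x y) F r y = lam r * F r x.
Hypothesis F_sum : forall x, x \notin S -> \sum_r F r x = (adj x v)%:R.
Implicit Types (r : 'I_d) (t : nat) (u w x y : V).

Let kR_gt0 : 0 < k%:R :> R. Proof. by rewrite ltr0n. Qed.
Let kR_neq0 : k%:R != 0 :> R. Proof. by rewrite gt_eqF. Qed.

(** For the intended [F], the functions [F r w] and [F r u] of the arc [(u, w)] have squared norm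
    [k * |F r|^2] and inner product [lam r * |F r|^2]; their inner products with the initial state
    are [kappa * |F r|^2] and 0. Solving this system gives the projection [kappa * wt r * (F r w -
    lam r / k * F r u)] of the initial state onto their span. *)
Let wt r : R := k%:R / (k%:R ^+ 2 - lam r ^+ 2).
Let angle r : R := acos (lam r / k%:R).
Let kappa : R := (Num.sqrt k%:R)^-1.

Lemma sqr_gap_gt0 r : 0 < k%:R ^+ 2 - lam r ^+ 2.
Proof.
by rewrite subr_gt0 -real_normK ?num_real// ltr_pXn2r ?nnegrE ?normr_ge0 ?ler0n.
Qed.

Lemma normr_cos_lt1 r : `|lam r / k%:R| < 1.
Proof. by rewrite normrM normfV normr_nat ltr_pdivrMr// mul1r. Qed.

Lemma cos_angle r : cos (angle r) = lam r / k%:R.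
Proof. by rewrite acosK// in_itv /= -ler_norml ltW// normr_cos_lt1. Qed.

(* The component of the initial state orthogonal to the invariant subspaces
   generated by the eigenvectors of the unmarked subgraph; on it the walk acts as
   minus the arc reversal. *)
Let rest u w : R :=
  kappa * ((u == v)%:R - \sum_r wt r * (F r w - lam r / k%:R * F r u)).

(* With N the normalised tail incidence matrix of the unmarked vertices and f an
   eigenvector of the unmarked subgraph for k cos th, the walk maps N^T f to
   R N^T f and R N^T f to 2 cos th R N^T f - N^T f, whence the cosines. *)
Definition walk_state t u w : R :=
  (if odd t then - rest w u else rest u w)
  + kappa * \sum_r wt r * (cos (t%:R * angle r) * F r w
                           - cos (t%:R * angle r - angle r) * F r u).

Lemma sum_nbr_cst x (a : R) : \sum_(y | adj x y) a = k%:R * a.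
Proof.
by rewrite sumr_const -(adj_reg x) cardsE mulr_natl.
Qed.

Lemma sum_nbr_eq x : \sum_(y | adj x y) (y == v)%:R = (adj x v)%:R :> R.
Proof.
have [xv|xv] := boolP (adj x v).
  by rewrite (bigD1 v)//= eqxx big1 ?addr0// => y /andP[_ /negbTE ->].
by rewrite big1// => y xy; case: eqP => // e; rewrite -e xy in xv.
Qed.

Lemma sum_nbr_lin (p q : 'I_d -> R) w : w \notin S ->
  \sum_(y | adj w y) \sum_r wt r * (p r * F r y + q r * F r w)
  = \sum_r wt r * (p r * lam r + q r * k%:R) * F r w.
Proof.
move=> wS; rewrite exchange_big; apply: eq_bigr => r _.
rewrite -mulr_sumr big_split /= -mulr_sumr F_eigen// sum_nbr_cst.
by ring.
Qed.

(** The coin sees a state only through such sums, so it acts on [rest] as -1. The contribution of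
    each [r] has the factor [lam r - lam r / k * k = 0]. *)
Lemma sum_rest w : w \notin S -> \sum_(y | adj w y) rest w y = 0.
Proof.
move=> wS; have wv : (w == v) = false.
  by apply/eqP => e; rewrite e v_marked in wS.
rewrite /rest wv -mulr_sumr sumrB sum_nbr_cst mulr0 sub0r.
under eq_bigr do under eq_bigr do rewrite -[F _ _]mul1r -mulNr.
rewrite sum_nbr_lin// big1 ?oppr0 ?mulr0// => r _.
by rewrite mulNr divfK// mul1r subrr mulr0 mul0r.
Qed.

(** This serves the odd times, when [rest] appears reversed. As [wt r * (k - lam r ^+ 2 / k) = 1],
    the eigenvector terms add up to [adj w v] by [F_sum]. *)
Lemma sum_rest_rev w : w \notin S -> \sum_(y | adj w y) rest y w = 0.
Proof.
move=> wS; rewrite /rest -mulr_sumr sumrB sum_nbr_eq.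
under eq_bigr do under eq_bigr do rewrite addrC -[X in _ + X]mul1r -mulNr.
rewrite sum_nbr_lin// -F_sum// -sumrB big1 ?mulr0// => r _.
have := sqr_gap_gt0 r => /lt0r_neq0 h; rewrite /wt; field.
by rewrite kR_neq0 h.
Qed.

(** By induction: each step reverses and negates [rest], and the eigenvalue equation at an unmarked
    vertex yields the recurrence [cosS] for the cosine coefficients. *)
Lemma walk_stateE t :
  walk R adj k S ^+ t *m init_state R adj k v = arc_vec adj (walk_state t).
Proof.
elim: t => [|t IH].
  rewrite expr0 mul1mx init_stateE; congr arc_vec.
  apply/funext => u; apply/funext => w.
  rewrite /walk_state /rest /= -mulrDr; congr (_ * _).
  rewrite -[LHS](subrK (\sum_r wt r * (F r w - lam r / k%:R * F r u))).
  congr (_ + _); apply: eq_bigr => r _.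
  by rewrite mul0r sub0r cosN cos0 mul1r cos_angle.
rewrite exprS -mulmxE -mulmxA IH walk_arc_vec//; congr arc_vec.
apply/funext => u; apply/funext => w; rewrite /walk_state /=.
have cosS r : cos (t.+1%:R * angle r)
    = 2 * (lam r / k%:R) * cos (t%:R * angle r) - cos (t%:R * angle r - angle r).
  by rewrite -cos_angle -natr1 mulrDl mul1r cosB cosD; ring.
have angleS r : t.+1%:R * angle r - angle r = t%:R * angle r.
  by rewrite -natr1 mulrDl mul1r addrK.
(* At a marked [w] the coin only changes the sign, and the new coefficient of [F r w = 0] is
   arbitrary. *)
case: ifPn => wS.
  rewrite sub0r opprD; congr (_ + _); first by case: (odd t); rewrite ?opprK.
  rewrite -mulrN -sumrN; congr (_ * _); apply: eq_bigr => r _.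
  by rewrite (F_marked _ _ wS) angleS; ring.
rewrite big_split /=.
have -> : \sum_(y | adj w y) (if odd t then - rest y w else rest w y) = 0.
  by case: (odd t); rewrite ?sumrN ?sum_rest ?sum_rest_rev ?oppr0.
rewrite add0r opprD addrCA; congr (_ + _).
  by case: (odd t); rewrite ?opprK.
rewrite -mulr_sumr.
under [X in _ * (_ * X)]eq_bigr do under eq_bigr do rewrite -mulNr.
rewrite sum_nbr_lin// mulrCA -mulrBr; congr (_ * _).
rewrite mulr_sumr -sumrB; apply: eq_bigr => r _.
by rewrite cosS angleS; field.
Qed.

Lemma cos_angle_sqr_neq1 r : cos (angle r) ^+ 2 != 1.
Proof.
rewrite cos_angle -real_normK ?num_real// lt_eqF//.
by rewrite expr_lt1// normr_cos_lt1.
Qed.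

(** As [F r u = 0], the state alternates between [rest u w] and [- rest w u], which amounts to
    frequencies 0 and [pi] with half the difference and half the sum as coefficients, on top of the
    frequencies [angle r]. *)
Lemma mean_to_walk_state u w : u \in S ->
  mean_to (fun t => walk_state t u w ^+ 2)
    (2^-1 * (rest u w ^+ 2 + rest w u ^+ 2)
     + 2^-1 * \sum_r (kappa * wt r * F r w) ^+ 2).
Proof.
move=> uS.
pose th (i : bool + 'I_d) := match i with inl b => b%:R * pi | inr r => angle r end.
pose c (i : bool + 'I_d) := match i with
  | inl b => 2^-1 * (if b then rest u w + rest w u else rest u w - rest w u)
  | inr r => kappa * wt r * F r w end.
have cos_bool (b : bool) : cos (b%:R * pi) = (-1) ^+ b :> R.
  by case: b; rewrite ?mul0r ?mul1r ?cos0 ?cospi.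
have th_inj : injective (cos \o th).
  have nb b r : cos (th (inl b)) <> cos (th (inr r)).
    move=> e; have /eqP := cos_angle_sqr_neq1 r; apply.
    by rewrite -e /= cos_bool sqrr_sign.
  case=> [b|r] [b'|r'] /= e; last 1 first.
  - move: e; rewrite !cos_angle => /(mulIf _) e; congr inr; apply: lam_inj.
    by apply: e; rewrite invr_eq0.
  - move: e; rewrite !cos_bool.
    by case: b; case: b' => //; rewrite expr0 expr1 => e; exfalso; lra.
  - by case: (nb b r').
  - by case: (nb b' r).
have cos_natpi t : cos (t%:R * pi) = (-1) ^+ odd t :> R.
  elim: t => [|t IH]; first by rewrite mul0r cos0.
  by rewrite -natr1 mulrDl mul1r cosDpi IH /=; case: odd; rewrite ?opprK.
have := mean_to_sqr_sum_cos _ c _ th_inj.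
congr mean_to.
  apply/funext => t; congr (_ ^+ 2).
  rewrite big_sumType big_bool /= mul0r mulr0 cos0 mulr1 mul1r cos_natpi.
  rewrite /walk_state; congr (_ + _).
    by case: (odd t) => /=; field.
  rewrite mulr_sumr; apply: eq_bigr => r _.
  by rewrite (F_marked _ _ uS); ring.
rewrite big_sumType big_bool /= mul0r mul1r cos0 cospi sqrrN expr1n eqxx; congr (_ + _).
  by field.
rewrite mulr_sumr; apply: eq_bigr => r _.
by rewrite (negbTE (cos_angle_sqr_neq1 r)) mulrC.
Qed.

(** In spectral form, [resL] and [resQ] are the inverses of the unmarked blocks of [lapl] and
    [slapl] applied to the indicator of the neighbours of [v]. *)
Let resL w := \sum_r (k%:R - lam r)^-1 * F r w.
Let resQ w := \sum_r (k%:R + lam r)^-1 * F r w.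

Lemma lim_vertex_prob u : u \in S ->
  limn (fun T : nat =>
    T%:R^-1 * \sum_(0 <= t < T) vertex_prob R adj k S t u v)
  = (2 * k%:R)^-1 * ((u == v)%:R * (k%:R - \sum_(w | adj u w) (resL w + resQ w))
                     + (adj u v)%:R)
    + k%:R / 2 * \sum_(w | adj u w)
        \sum_r ((k%:R ^+ 2 - lam r ^+ 2) ^+ 2)^-1 * F r w ^+ 2
    + (4 * k%:R)^-1 * \sum_(w | adj u w) (resL w ^+ 2 + resQ w ^+ 2).
Proof.
move=> uS; under eq_fun do under eq_bigr do rewrite (vertex_probE _ _ _ _ _ walk_stateE).
have := mean_to_sum V (adj u) (fun=> 1) _ _
  (fun w _ => mean_to_walk_state u w uS).
under eq_fun do under eq_bigr do rewrite mul1r.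
move/cvg_lim => -> //.
have den r : [&& k%:R + lam r != 0, k%:R - lam r != 0 & k%:R ^+ 2 - lam r ^+ 2 != 0].
  have := lam_lt r; rewrite ltr_norml => /andP[lo hi].
  by rewrite !gt_eqF ?sqr_gap_gt0 ?subr_gt0 -?ltrBlDl ?sub0r.
have kappa2 : kappa ^+ 2 = k%:R^-1 by rewrite exprVn sqr_sqrtr ?ler0n.
(* Partial fractions: [k / (k^2 - lam^2)] and [lam / (k^2 - lam^2)] are half the sum and half the
   difference of [1 / (k - lam)] and [1 / (k + lam)]. *)
have resE w : \sum_r wt r * (F r w - lam r / k%:R * F r u) = 2^-1 * (resL w + resQ w).
  rewrite -big_split mulr_sumr; apply: eq_bigr => r _ /=.
  rewrite (F_marked _ _ uS) /wt; field.
  by have /and3P[-> -> ->] := den r; rewrite kR_neq0.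
have resE' w : \sum_r wt r * (F r u - lam r / k%:R * F r w) = 2^-1 * (resQ w - resL w).
  rewrite -sumrB mulr_sumr; apply: eq_bigr => r _ /=.
  rewrite (F_marked _ _ uS) /wt; field.
  by have /and3P[-> -> ->] := den r; rewrite kR_neq0.
rewrite -(sum_nbr_eq u).
have -> : forall a, a * (k%:R - \sum_(w | adj u w) (resL w + resQ w))
   = \sum_(w | adj u w) a * (1 - (resL w + resQ w)).
  by move=> a; rewrite -mulr_sumr sumrB sum_nbr_cst mulr1.
rewrite -big_split !mulr_sumr -!big_split /=; apply: eq_bigr => w _.
rewrite mul1r /rest resE resE' !exprMn kappa2.
have -> : \sum_r (kappa * wt r * F r w) ^+ 2
    = k%:R * \sum_r ((k%:R ^+ 2 - lam r ^+ 2) ^+ 2)^-1 * F r w ^+ 2.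
  rewrite mulr_sumr; apply: eq_bigr => r _; rewrite !exprMn kappa2 exprVn.
  by field; have /and3P[_ _ ->] := den r; rewrite kR_neq0.
(* The cross term vanishes, because every [F r] is 0 at the marked vertex [v]. *)
have wv0 : (w == v)%:R * (resQ w - resL w) = 0 :> R.
  case: eqP => [->|_]; last by rewrite mul0r.
  by rewrite /resQ /resL !big1 ?subrr ?mulr0// => r _; rewrite F_marked ?mulr0.
have -> : ((w == v)%:R - 2^-1 * (resQ w - resL w)) ^+ 2
    = (w == v)%:R + (2^-1 * (resQ w - resL w)) ^+ 2.
  rewrite sqrrB [_%:R * (_ * _)]mulrCA wv0 mulr0 mul0rn subr0.
  by case: eqP; rewrite ?expr1n ?expr0n.
case: (u == v) => /=; field; exact: kR_neq0.
Qed.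

End WalkFormula.

(** * The unmarked subgraph *)

Section MarkedGraph.
Context {R : realType} {V : finType} (adj : rel V) (k : nat) (S : {set V}).
Hypotheses (adj_sym : symmetric adj) (adj_conn : connected_graph adj).
Hypothesis adj_reg : regular_graph adj k.
Hypothesis S_nonempty : S != finset.set0.

(* At a vertex where |F| is maximal, |a| = k would force |F| to be maximal at all
   neighbours, hence everywhere by connectedness, although F vanishes on S. *)
Lemma normr_eigenvalue_lt (F : V -> R) (a : R) x0 :
  (forall x, x \in S -> F x = 0) ->
  (forall x, x \notin S -> \sum_(y | adj x y) F y = a * F x) ->
  F x0 != 0 -> `|a| < k%:R.
Proof.
move=> F_marked F_eigen Fx0.
have [x _ xmax'] := @arg_maxP _ _ _ x0 xpredT (fun x => `|F x|) isT.
have xmax y : `|F y| <= `|F x| by exact: xmax'.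
have Fx_gt0 : 0 < `|F x| by rewrite (lt_le_trans _ (xmax x0))// normr_gt0.
rewrite ltNge; apply/negP => ka.
have [s sS] := set0Pn _ S_nonempty.
pose top := [pred y | `|F y| == `|F x|].
have top_step y z : adj y z -> y \in top -> z \in top.
  rewrite !inE => yz /eqP ytop.
  have yS : y \notin S.
    by apply: contraTN Fx_gt0 => /F_marked yF; rewrite -ytop yF normr0 ltxx.
  have dev_ge0 w : adj y w -> 0 <= `|F x| - `|F w| by rewrite subr_ge0 xmax.
  (* Here [k * |F x| <= |a| * |F y| <= \sum_w |F w|], so these nonnegative terms have a sum of at
     most 0. *)
  have : \sum_(w | adj y w) (`|F x| - `|F w|) = 0.
    apply/le_anti; rewrite sumr_ge0// andbT.
    rewrite sumrB sumr_const -(cardsE (adj y)) adj_reg -mulr_natl subr_le0.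
    rewrite (le_trans _ (ler_norm_sum _ _ _))// F_eigen// normrM ytop.
    by rewrite ler_wpM2r.
  move/(psumr_eq0P dev_ge0) => /(_ z yz)/eqP.
  by rewrite subr_eq0 eq_sym.
have := closed_connect (intro_closed (sym_connect_sym adj_sym) top_step) (adj_conn x s).
by rewrite !inE eqxx (F_marked _ sS) normr0 lt_eqF.
Qed.

Definition ext0 (f : 'I_#|~: S| -> R) (x : V) : R :=
  \sum_l (enum_val l == x)%:R * f l.

Lemma ext0_marked f x : x \in S -> ext0 f x = 0.
Proof.
move=> xS; rewrite /ext0 big1// => l _; case: eqP => [lx|]; last by rewrite mul0r.
by have := enum_valP l; rewrite lx inE xS.
Qed.

Lemma ext0_val f l : ext0 f (enum_val l) = f l.
Proof.
rewrite /ext0 (bigD1 l)//= eqxx mul1r big1 ?addr0// => m ml.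
by rewrite (inj_eq enum_val_inj) (negbTE ml) mul0r.
Qed.

Lemma sum_nbr_unmarked (phi : V -> R) x : (forall y, y \in S -> phi y = 0) ->
  \sum_(y | adj x y) phi y
  = \sum_(l < #|~: S|) (adj x (enum_val l))%:R * phi (enum_val l) :> R.
Proof.
move=> phi0; rewrite -(big_enum_val (fun y => (adj x y)%:R * phi y)).
rewrite [LHS]big_mkcond [RHS]big_mkcond; apply: eq_bigr => y _ /=.
rewrite inE; case: ifP => xy; case: ifPn => yS; rewrite ?mul1r ?mul0r//.
by rewrite phi0// -[_ \in _]negbK.
Qed.

Lemma sum_nbr_ext0 f x :
  \sum_(y | adj x y) ext0 f y = \sum_l (adj x (enum_val l))%:R * f l.
Proof.
rewrite sum_nbr_unmarked => [|y]; last exact: ext0_marked.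
by apply: eq_bigr => l _; rewrite ext0_val.
Qed.

Lemma adj_submatrixE (A B : {set V}) i j :
  submatrix (adjmx R adj) A B i j = (adj (enum_val i) (enum_val j))%:R.
Proof. by rewrite !mxE !enum_rankK. Qed.

Let B := submatrix (adjmx R adj) (~: S) (~: S).

Lemma unmarked_tr : B^T = B.
Proof. by apply/matrixP => i j; rewrite mxE !adj_submatrixE adj_sym. Qed.

Lemma unmarked_enum_val x : x \notin S -> exists l : 'I_#|~: S|, x = enum_val l.
Proof.
move=> xS; have xC : x \in ~: S by rewrite inE.
by exists (enum_rank_in xC x); rewrite enum_rankK_in.
Qed.

(** An eigenvector is extended by zero to [S]. Strictness keeps the angles off 0 and [pi] and makes
    the unmarked blocks of [lapl] and [slapl] invertible. *)
Lemma unmarked_eigenvalue_lt a : eigenvalue B a -> `|a| < k%:R.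
Proof.
move=> /eigenvalueP[f fB f0]; have /rV0Pn[l fl] := f0.
apply: (normr_eigenvalue_lt (ext0 (f 0)) _ (enum_val l)).
- exact: ext0_marked.
- move=> x /unmarked_enum_val[m ->]; rewrite sum_nbr_ext0 ext0_val.
  have /matrixP/(_ 0 m) := fB; rewrite !mxE => <-; apply: eq_bigr => i _.
  by rewrite adj_submatrixE mulrC adj_sym.
- by rewrite ext0_val.
Qed.

(** [M] acts on the range of [G r] as [mu r], so the sum is a right inverse, hence the inverse of a
    square matrix. *)
Lemma invmx_spectral n (M : 'M[R]_n) d (mu : 'I_d -> R) (G : 'I_d -> 'M[R]_n) :
  (forall r, M *m G r = mu r *: G r) -> (forall r, mu r != 0) ->
  \sum_r G r = 1%:M -> invmx M = \sum_r (mu r)^-1 *: G r.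
Proof.
move=> MG mu0 G1; have M1 : M *m (\sum_r (mu r)^-1 *: G r) = 1%:M.
  rewrite mulmx_sumr -G1; apply: eq_bigr => r _.
  by rewrite -scalemxAr MG scalerA mulVf// scale1r.
have [Mu _] := mulmx1_unit M1.
by rewrite -[LHS]mulmx1 -M1 mulKmx.
Qed.

Lemma submatrix_lapl (A : {set V}) :
  submatrix (lapl R adj k) A A = k%:R%:M - submatrix (adjmx R adj) A A.
Proof.
by apply/matrixP => i j; rewrite !mxE (inj_eq enum_rank_inj) (inj_eq enum_val_inj).
Qed.

Lemma submatrix_slapl (A : {set V}) :
  submatrix (slapl R adj k) A A = k%:R%:M + submatrix (adjmx R adj) A A.
Proof.
by apply/matrixP => i j; rewrite !mxE (inj_eq enum_rank_inj) (inj_eq enum_val_inj).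
Qed.

Lemma blockHE i l : blockH R adj S i l = (adj (enum_val i) (enum_val l))%:R.
Proof. exact: adj_submatrixE. Qed.

Lemma out_degE i :
  (out_deg adj S (enum_val i))%:R = \sum_l blockH R adj S i l.
Proof.
rewrite /out_deg -sum1_card natr_sum.
transitivity (\sum_(b in ~: S) (adj (enum_val i) b)%:R : R).
  by rewrite big_mkcond [RHS]big_mkcond; apply: eq_bigr => b _; rewrite !inE; case: (b \in S); case: adj.
by rewrite big_enum_val; apply: eq_bigr => l _; rewrite blockHE.
Qed.

End MarkedGraph.

(* Lagrange's identity for weighted sums. *)
Lemma cauchy_schwarz_gap {R : realType} (I : finType) (h x : I -> R) :
  (\sum_i h i) * (\sum_i h i * x i ^+ 2) - (\sum_i h i * x i) ^+ 2
  = 2^-1 * \sum_i \sum_j h i * h j * (x i - x j) ^+ 2.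
Proof.
have -> : \sum_i \sum_j h i * h j * (x i - x j) ^+ 2
    = \sum_i \sum_j h i * (h j * x j ^+ 2) + \sum_i \sum_j (h i * x i ^+ 2) * h j
      - 2 * \sum_i \sum_j (h i * x i) * (h j * x j).
  rewrite mulr_sumr -!big_split -sumrB /=; apply: eq_bigr => i _.
  rewrite mulr_sumr -!big_split -sumrB /=; apply: eq_bigr => j _; ring.
by rewrite -!big_distrlr /=; field.
Qed.

(** * Comparison with the bound *)

Section MixingBound.
Context {R : realType} {V : finType} (adj : rel V) (k : nat) (S : {set V}).
Context (d : nat) (lam : 'I_d -> R) (G : 'I_d -> 'M[R]_#|~: S|).
Hypotheses (adj_sym : symmetric adj) (adj_conn : connected_graph adj).
Hypothesis adj_reg : regular_graph adj k.
Hypothesis S_nonempty : S != finset.set0.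
Hypothesis specG :
  spectral_decomposition (submatrix (adjmx R adj) (~: S) (~: S)) lam G.

Let B := submatrix (adjmx R adj) (~: S) (~: S).
Let L := lapl R adj k.
Let Q := slapl R adj k.
Let H := blockH R adj S.
Let iL := invmx (submatrix L (~: S) (~: S)).
Let iQ := invmx (submatrix Q (~: S) (~: S)).
Let Delta := out_degmx R adj S.

Definition mixing_bound : 'M[R]_#|S| :=
  (2 * k%:R)^-1 *: schur_prod 1%:M (schurL R adj k S + schurQ R adj k S)
  - (2 * k%:R)^-1 *: submatrix L S S
  + (k%:R / 2) *:
      (H *m (\sum_r ((k%:R ^+ 2 - lam r ^+ 2) ^+ 2)^-1 *:
               schur_prod (G r) (G r)) *m H^T *m Delta)
  + (4 * k%:R)^-1 *:
      (H *m (schur_prod iL iL + schur_prod iQ iQ) *m H^T *m Delta).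

Lemma lam_lt r : `|lam r| < k%:R.
Proof.
by case: specG => _ /(_ r) ev _ _ _; exact: unmarked_eigenvalue_lt ev.
Qed.

(** Row eigenspaces give [G r *m B = lam r *: G r]; transposing these symmetric matrices moves [B]
    to the left. *)
Lemma unmarked_mul_proj r : B *m G r = lam r *: G r.
Proof.
case: specG => _ _ /(_ r)[Gtr _ GE] _ _.
have /eigenspaceP GB : (G r <= eigenspace B (lam r))%MS by rewrite GE.
by rewrite -[LHS]trmxK trmx_mul unmarked_tr// Gtr GB linearZ /= Gtr.
Qed.

Lemma iL_spectral : iL = \sum_r (k%:R - lam r)^-1 *: G r.
Proof.
apply: invmx_spectral; last by case: specG.
- by move=> r; rewrite submatrix_lapl mulmxBl unmarked_mul_proj mul_scalar_mx scalerBl.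
- by move=> r; have := lam_lt r; rewrite ltr_norml => /andP[_ ?]; rewrite gt_eqF ?subr_gt0.
Qed.

Lemma iQ_spectral : iQ = \sum_r (k%:R + lam r)^-1 *: G r.
Proof.
apply: invmx_spectral; last by case: specG.
- by move=> r; rewrite submatrix_slapl mulmxDl unmarked_mul_proj mul_scalar_mx scalerDl.
- move=> r; have := lam_lt r; rewrite ltr_norml => /andP[? _].
  by rewrite gt_eqF// -ltrBlDl sub0r.
Qed.

(** The Cauchy-Schwarz defect of row [l] of [N] under the 0-1 weights [H j], whose total is the
    out-degree of the marked vertex [j]. *)
Definition cs_gap (N : 'M[R]_#|~: S|) l (j : 'I_#|S|) : R :=
  (\sum_m H j m) * (\sum_m H j m * N l m ^+ 2) - (\sum_m H j m * N l m) ^+ 2.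

Lemma H_ge0 j m : 0 <= H j m. Proof. by rewrite blockHE ler0n. Qed.

Lemma cs_gap_ge0 N l j : 0 <= cs_gap N l j.
Proof.
rewrite /cs_gap cauchy_schwarz_gap mulr_ge0 ?invr_ge0//.
do 2!(apply: sumr_ge0 => ? _).
exact: mulr_ge0 (mulr_ge0 (H_ge0 _ _) (H_ge0 _ _)) (sqr_ge0 _).
Qed.

(** In Lagrange's identity the terms with [m = n] vanish, and for [m != n] two weights 1 would give
    a row sum of at least 2. *)
Lemma cs_gap_out_deg_le1 N l j :
  (out_deg adj S (enum_val j) <= 1)%N -> cs_gap N l j = 0.
Proof.
rewrite -(ler_nat R) out_degE -/H => deg1.
rewrite /cs_gap cauchy_schwarz_gap big1 ?mulr0// => m _; rewrite big1// => n _.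
have [->|mn] := eqVneq m n; first by rewrite subrr expr0n mulr0.
suff -> : H j m * H j n = 0 by rewrite mul0r.
have s0 : 0 <= \sum_(i < #|~: S| | (i != m) && (i != n)) H j i.
  by apply: sumr_ge0 => ? _; exact: H_ge0.
rewrite (bigD1 m)//= (bigD1 n) 1?eq_sym//= !blockHE in deg1 *.
move: (\sum_(_ | _) _) s0 deg1 => s.
case: (adj _ (enum_val m)); rewrite ?mul0r//.
case: (adj _ (enum_val n)); rewrite ?mulr0//= => s0 s1.
exfalso; lra.
Qed.

Lemma cs_gap_eq0 N l j m n : cs_gap N l j = 0 ->
  H j m = 1 -> H j n = 1 -> N l m = N l n.
Proof.
rewrite /cs_gap cauchy_schwarz_gap => /eqP; rewrite mulf_eq0 invr_eq0 pnatr_eq0 /=.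
move=> /eqP /psumr_eq0P e Hm Hn.
have ge0 i i' : 0 <= H j i * H j i' * (N l i - N l i') ^+ 2.
  exact: mulr_ge0 (mulr_ge0 (H_ge0 _ _) (H_ge0 _ _)) (sqr_ge0 _).
have := e (fun i _ => sumr_ge0 _ (fun i' _ => ge0 i i')) m isT.
move/psumr_eq0P => /(_ (fun i _ => ge0 m i) n isT) /eqP.
by rewrite Hm Hn !mul1r sqrf_eq0 subr_eq0 => /eqP.
Qed.

Lemma mulH_Delta (N : 'M[R]_#|~: S|) i j :
  (H *m N *m H^T *m Delta) i j
  = \sum_l H i l * ((\sum_m H j m) * \sum_m H j m * N l m).
Proof.
rewrite /Delta /out_degmx mul_mx_diag mxE [X in _ * X]mxE out_degE -/H mulrC.
rewrite -mulmxA mxE.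
rewrite mulr_sumr; apply: eq_bigr => l _; rewrite mulrCA !mxE; congr (_ * (_ * _)).
by apply: eq_bigr => m _; rewrite !mxE mulrC.
Qed.

(** The exact formula has squared weighted sums where the bound has out-degree times weighted sums
    of squares, for the matrices [G r], [iL] and [iQ]; all other terms agree. *)
Lemma mixing_bound_gap i j : (0 < k)%N ->
  mixing_bound i j - submatrix (avg_mixing R adj k S) S S i j
  = k%:R / 2 * (\sum_l H i l *
      \sum_r ((k%:R ^+ 2 - lam r ^+ 2) ^+ 2)^-1 * cs_gap (G r) l j)
    + (4 * k%:R)^-1 * (\sum_l H i l * (cs_gap iL l j + cs_gap iQ l j)).
Proof.
move=> k0; case: (specG) => lam_inj _ _ G1 _.
(* Column [j] of [G r *m H^T] is the projected indicator of the unmarked neighbours of vertex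
   [j]. *)
pose F r := ext0 S (fun l => (G r *m H^T) l j).
have F_marked r x : x \in S -> F r x = 0 by exact: ext0_marked.
have F_eigen r x : x \notin S -> \sum_(y | adj x y) F r y = lam r * F r x.
  move=> /unmarked_enum_val[m ->]; rewrite sum_nbr_ext0 /F ext0_val.
  have /matrixP/(_ m j) := congr1 (mulmx^~ H^T) (unmarked_mul_proj r).
  rewrite /= -mulmxA -scalemxAl [RHS]mxE => <-; rewrite [RHS]mxE.
  by apply: eq_bigr => l _; rewrite /B adj_submatrixE.
have F_sum x : x \notin S -> \sum_r F r x = (adj x (enum_val j))%:R.
  move=> /unmarked_enum_val[m ->].
  have /matrixP/(_ m j) := congr1 (mulmx^~ H^T) G1.
  rewrite /= mul1mx mulmx_suml summxE mxE blockHE adj_sym => <-.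
  by apply: eq_bigr => r _; rewrite /F ext0_val.
have res_val (a : 'I_d -> R) l : \sum_r a r * F r (enum_val l)
    = \sum_m H j m * (\sum_r a r *: G r) l m.
  under [RHS]eq_bigr do rewrite summxE mulr_sumr.
  rewrite exchange_big; apply: eq_bigr => r _.
  rewrite /F ext0_val mxE mulr_sumr; apply: eq_bigr => m _ /=.
  by rewrite !mxE; ring.
have res_marked (a : 'I_d -> R) y : y \in S -> \sum_r a r * F r y = 0.
  by move=> yS; rewrite big1// => r _; rewrite F_marked ?mulr0.
pose PL l := \sum_m H j m * iL l m.
pose PQ l := \sum_m H j m * iQ l m.
have nbrE (phi : V -> R) : (forall y, y \in S -> phi y = 0) ->
    \sum_(y | adj (enum_val i) y) phi y = \sum_l H i l * phi (enum_val l).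
  move=> /sum_nbr_unmarked ->; apply: eq_bigr => l _.
  by rewrite blockHE.
have resL_val l : \sum_r (k%:R - lam r)^-1 * F r (enum_val l) = PL l.
  by rewrite res_val -iL_spectral.
have resQ_val l : \sum_r (k%:R + lam r)^-1 * F r (enum_val l) = PQ l.
  by rewrite res_val -iQ_spectral.
have F_val r l : F r (enum_val l) = \sum_m H j m * G r l m.
  by rewrite /F ext0_val mxE; apply: eq_bigr => m _; rewrite mxE mulrC.
rewrite [submatrix (avg_mixing _ _ _ _) _ _ _ _]mxE [avg_mixing _ _ _ _ _ _]mxE.
rewrite !enum_rankK.
rewrite (lim_vertex_prob _ _ _ _ _ _ _ adj_sym adj_reg k0 lam_inj lam_lt (enum_valP j)
    F_marked F_eigen F_sum _ (enum_valP i)).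
rewrite !nbrE; first last.
- by move=> y yS; rewrite !res_marked// addr0.
- by move=> y yS; rewrite big1// => r _; rewrite F_marked// expr0n mulr0.
- by move=> y yS; rewrite !res_marked// expr0n addr0.
under eq_bigr do rewrite resL_val resQ_val.
under [X in _ + k%:R / 2 * X]eq_bigr do under eq_bigr do rewrite F_val.
under [X in (4 * k%:R)^-1 * X]eq_bigr do rewrite resL_val resQ_val.
have schur_gapE (N : 'M[R]_#|~: S|) l :
    (\sum_m H j m) * (\sum_m H j m * schur_prod N N l m)
    = cs_gap N l j + (\sum_m H j m * N l m) ^+ 2.
  rewrite /cs_gap subrK; congr (_ * _); apply: eq_bigr => m _.
  by rewrite [schur_prod _ _ _ _]mxE expr2.
have resolventE (N : 'M[R]_#|~: S|) :
    (H *m N *m H^T) i j = \sum_l H i l * \sum_m H j m * N l m.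
  rewrite -mulmxA mxE; apply: eq_bigr => l _; congr (_ * _); rewrite mxE.
  by apply: eq_bigr => m _; rewrite mxE mulrC.
have proj_gapE : (H *m (\sum_r ((k%:R ^+ 2 - lam r ^+ 2) ^+ 2)^-1 *:
               schur_prod (G r) (G r)) *m H^T *m Delta) i j
    = \sum_l H i l * \sum_r ((k%:R ^+ 2 - lam r ^+ 2) ^+ 2)^-1 * cs_gap (G r) l j
    + \sum_l H i l * \sum_r ((k%:R ^+ 2 - lam r ^+ 2) ^+ 2)^-1
        * (\sum_m H j m * G r l m) ^+ 2.
  rewrite mulH_Delta -big_split; apply: eq_bigr => l _ /=.
  rewrite -mulrDr -big_split /=; congr (_ * _).
  under [X in _ * X = _]eq_bigr do rewrite summxE mulr_sumr.
  rewrite exchange_big mulr_sumr; apply: eq_bigr => r _ /=.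
  rewrite -mulrDr -schur_gapE mulrCA [in RHS]mulr_sumr; congr (_ * _).
  by apply: eq_bigr => m _; rewrite !mxE; ring.
have res_gapE : (H *m (schur_prod iL iL + schur_prod iQ iQ) *m H^T *m Delta) i j
    = \sum_l H i l * (cs_gap iL l j + cs_gap iQ l j)
    + \sum_l H i l * (PL l ^+ 2 + PQ l ^+ 2).
  rewrite mulH_Delta -big_split; apply: eq_bigr => l _ /=.
  rewrite -mulrDr; congr (_ * _).
  rewrite addrACA -!schur_gapE -mulrDr -big_split /=; congr (_ * _).
  by apply: eq_bigr => m _; rewrite !mxE mulrDr.
have resE : \sum_l H i l * (PL l + PQ l)
    = (H *m iL *m H^T) i j + (H *m iQ *m H^T) i j.
  by rewrite !resolventE -big_split; apply: eq_bigr => l _; rewrite mulrDr.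
have mxDE (M N : 'M[R]_#|S|) : (M + N) i j = M i j + N i j by rewrite mxE.
have mxNE (M : 'M[R]_#|S|) : (- M) i j = - M i j by rewrite mxE.
have mxZE a (M : 'M[R]_#|S|) : (a *: M) i j = a * M i j by rewrite mxE.
rewrite /mixing_bound !mxDE !mxNE !mxZE proj_gapE res_gapE resE.
(* Since [L_S + Q_S = 2 k I], the bound contains [2 k I - L_S = k I + A_S], which matches the [k]
   and the adjacency term of [lim_vertex_prob]. *)
rewrite [schur_prod 1%:M _ i j]mxE /schurL /schurQ -/L -/Q -/H -/iL -/iQ.
rewrite (submatrix_lapl adj k S) (submatrix_slapl adj k S) !mxDE !mxNE.
rewrite [1%:M i j]mxE [k%:R%:M i j]mxE adj_submatrixE (inj_eq enum_val_inj).
move: (\sum_l _ * \sum_r _ * cs_gap _ _ _) (\sum_l _ * (cs_gap _ _ _ + _)) => gapG gapR.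
move: (\sum_l _ * \sum_r _ * _) (\sum_l _ * (_ + _)) => meanG meanR.
move: ((H *m iL *m H^T) i j) ((H *m iQ *m H^T) i j) => resL resQ.
have kn : k%:R != 0 :> R by rewrite pnatr_eq0 -lt0n.
by case: (i == j); rewrite ?mulr1n ?mulr0n /=; field.
Qed.

Lemma wt_gt0 r : 0 < ((k%:R ^+ 2 - lam r ^+ 2) ^+ 2)^-1 :> R.
Proof. by rewrite invr_gt0 exprn_gt0// sqr_gap_gt0//; exact: lam_lt. Qed.

Lemma proj_gap_ge0 l j :
  0 <= \sum_r ((k%:R ^+ 2 - lam r ^+ 2) ^+ 2)^-1 * cs_gap (G r) l j.
Proof.
by apply: sumr_ge0 => r _; rewrite mulr_ge0 ?cs_gap_ge0 ?(ltW (wt_gt0 r)).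
Qed.

Lemma avg_mixing_le_bound i j : (0 < k)%N ->
  submatrix (avg_mixing R adj k S) S S i j <= mixing_bound i j.
Proof.
move=> k0; rewrite -subr_ge0 mixing_bound_gap//.
apply: addr_ge0; apply: mulr_ge0; rewrite ?divr_ge0 ?invr_ge0 ?mulr_ge0 ?ler0n//;
  apply: sumr_ge0 => l _; apply: mulr_ge0 (H_ge0 _ _) _.
- exact: proj_gap_ge0.
- by rewrite addr_ge0 ?cs_gap_ge0.
Qed.

Lemma avg_mixing_eq_bound : (0 < k)%N ->
  submatrix (avg_mixing R adj k S) S S = mixing_bound <->
  (forall a : V, a \in S -> (out_deg adj S a <= 1)%N).
Proof.
move=> k0; split=> [eqM a aS | deg1]; last first.
  apply/matrixP => i j; apply/esym/eqP; rewrite -subr_eq0 mixing_bound_gap//.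
  have g0 N l : cs_gap N l j = 0 by apply/cs_gap_out_deg_le1/deg1/enum_valP.
  rewrite !big1 ?mulr0 ?addr0// => l _; first by rewrite !g0 addr0 mulr0.
  by rewrite big1 ?mulr0// => r _; rewrite g0 mulr0.
pose j := enum_rank_in aS a; have ja : enum_val j = a by rewrite enum_rankK_in.
rewrite leqNgt; apply/negP => /card_gt1P[x [y []]].
rewrite !inE => /andP[/unmarked_enum_val[l ->] al] /andP[/unmarked_enum_val[n ->] an].
rewrite (inj_eq enum_val_inj) => ln.
have Hl : H j l = 1 by rewrite blockHE ja al.
have Hn : H j n = 1 by rewrite blockHE ja an.
have kR : 0 < k%:R :> R by rewrite ltr0n.
(* The diagonal entry at [a] suffices: its projection part has a summand [l] of weight [H j l = 1],
   so the gaps of all [G r] vanish there. *)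
have := mixing_bound_gap j j k0; rewrite eqM subrr => /esym/eqP.
have A0 m : 0 <= H j m *
    \sum_r ((k%:R ^+ 2 - lam r ^+ 2) ^+ 2)^-1 * cs_gap (G r) m j.
  by apply: mulr_ge0; [exact: H_ge0|exact: proj_gap_ge0].
have B0 m : 0 <= H j m * (cs_gap iL m j + cs_gap iQ m j).
  by apply: mulr_ge0 (H_ge0 _ _) _; rewrite addr_ge0 ?cs_gap_ge0.
rewrite paddr_eq0; first last.
- by rewrite mulr_ge0 ?invr_ge0 ?mulr_ge0 ?ler0n ?sumr_ge0.
- by rewrite mulr_ge0 ?divr_ge0 ?ler0n ?sumr_ge0.
move=> /andP[+ _]; rewrite mulf_eq0 gt_eqF ?divr_gt0//= => /eqP.
move/(psumr_eq0P (fun m _ => A0 m)) => /(_ l isT); rewrite Hl mul1r.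
have gap_ge0 r : 0 <= ((k%:R ^+ 2 - lam r ^+ 2) ^+ 2)^-1 * cs_gap (G r) l j.
  exact: mulr_ge0 (ltW (wt_gt0 r)) (cs_gap_ge0 _ _ _).
move/(psumr_eq0P (fun r _ => gap_ge0 r)) => gap0.
have GE r : G r l l = G r l n.
  apply: (cs_gap_eq0 _ _ j) => //; have /eqP := gap0 r isT.
  by rewrite mulf_eq0 gt_eqF ?wt_gt0//= => /eqP.
case: (specG) => _ _ _ G1 _.
(* Summing over [r] equates a diagonal and an off-diagonal entry of the identity. *)
have : (\sum_r G r) l l = (\sum_r G r) l n by rewrite !summxE; apply: eq_bigr.
by rewrite G1 !mxE eqxx (negbTE ln) => /eqP; rewrite oner_eq0.
Qed.

Lemma avg_mixing_edgeless i j : (forall x y, ~~ adj x y) ->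
  submatrix (avg_mixing R adj k S) S S i j = 0.
Proof.
move=> noadj; have p0 t u v : vertex_prob R adj k S t u v = 0.
  rewrite /vertex_prob big1// => -[[x y] xy].
  by have := noadj x y; rewrite xy.
rewrite !mxE; under eq_fun do under eq_bigr do rewrite p0.
by under eq_fun do rewrite big1// mulr0; exact: lim_cst.
Qed.

End MixingBound.

Theorem theorem6p5 (R : realType) (V : finType) (adj : rel V) (k : nat)
  (S : {set V})
  (adj_sym : symmetric adj) (adj_irr : irreflexive adj)
  (adj_conn : connected_graph adj) (adj_reg : regular_graph adj k)
  (S_nonempty : S != finset.set0)
  (d : nat) (lam : 'I_d -> R) (G : 'I_d -> 'M[R]_#|~: S|)
  (specG : spectral_decomposition (submatrix (adjmx R adj) (~: S) (~: S)) lam G) :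
  let L := lapl R adj k in
  let Q := slapl R adj k in
  let H := blockH R adj S in
  let iL := invmx (submatrix L (~: S) (~: S)) in
  let iQ := invmx (submatrix Q (~: S) (~: S)) in
  let Delta := out_degmx R adj S in
  let Mhat := avg_mixing R adj k S in
  let bound :=
    (2 * k%:R)^-1 *: schur_prod 1%:M (schurL R adj k S + schurQ R adj k S)
    - (2 * k%:R)^-1 *: submatrix L S S
    + (k%:R / 2) *:
        (H *m (\sum_r ((k%:R ^+ 2 - lam r ^+ 2) ^+ 2)^-1 *:
                 schur_prod (G r) (G r)) *m H^T *m Delta)
    + (4 * k%:R)^-1 *:
        (H *m (schur_prod iL iL + schur_prod iQ iQ) *m H^T *m Delta) in
  (forall a b, submatrix Mhat S S a b <= bound a b)
  /\ (submatrix Mhat S S = bound <->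
      (forall a : V, a \in S -> (out_deg adj S a <= 1)%N)).
Proof.
move=> L Q H iL iQ Delta Mhat bound.
have boundE : bound = mixing_bound adj k S d lam G by [].
(* For [k = 0] there are no arcs, so mixing matrix and out-degrees are 0; the bound is 0 too, by the
   convention [0^-1 = 0]. *)
have [k0|k0] := posnP k; last first.
  rewrite boundE; split; last exact: avg_mixing_eq_bound.
  by move=> a b; exact: avg_mixing_le_bound.
have noadj x y : ~~ adj x y.
  apply/negP => xy; have /eqP := adj_reg x.
  by rewrite k0 cards_eq0 => /eqP/setP/(_ y); rewrite !inE xy.
have bound0 : bound = 0.
  by rewrite /bound k0 !mulr0 mul0r invr0 !scale0r subrr !addr0.
have M0 : submatrix Mhat S S = 0.
  by apply/matrixP => i j; rewrite avg_mixing_edgeless// mxE.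
rewrite M0 bound0; split=> //; split=> // _ a _.
rewrite /out_deg (_ : [set b in ~: S | adj a b] = finset.set0) ?cards0//.
by apply/setP => b; rewrite !inE (negbTE (noadj a b)) andbF.
Qed.
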